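(* There exists a universal $\delta>0$ such that the following holds for all sufficiently large $n\in\mathbb{N}$. If $\mathcal{H}$ is a collection of graphs on the vertex set $[n]$ and \[\sum_{H\in\mathcal{H}}\exp\left(-\delta e(H)/\sqrt{n}\right)<\frac12,\] then there is a triangle-free graph $G$ on $[n]$ sharing at least one edge with each $H\in\mathcal{H}$.
   Context: $e(H)$ denotes the number of edges of a graph $H$. *)

(* Defs.v *)
From HB Require Import structures.
From mathcomp Require Import all_boot all_order all_algebra.
Set Implicit Arguments.
Unset Strict Implicit.
Unset Printing Implicit Defensive.

(* A finite simple graph on T, given by its set of edges, an edge being a set
   of two vertices. *)
Record sgraph (T : finType) := SGraph {
  edges : {set {set T}};
  _ : [forall e in edges, #|e| == 2]
}.

HB.instance Definition _ (T : finType) := [isSub for @edges T].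
HB.instance Definition _ (T : finType) := [Countable of sgraph T by <:].
HB.instance Definition _ (T : finType) := [Finite of sgraph T by <:].

Section SGraphTheory.
Variable T : finType.
Implicit Types G H : sgraph T.

Definition adjacent G (x y : T) : bool := [set x; y] \in edges G.

Definition num_edges G : nat := #|edges G|.

(* No distinctness of x, y and z is required: [set x; x] has only one element,
   hence is never an edge, so adjacent vertices are distinct. *)
Definition triangle_free G : Prop :=
  forall x y z : T, ~ [/\ adjacent G x y, adjacent G y z & adjacent G x z].

Definition share_edge G H : Prop :=
  exists2 e : {set T}, e \in edges G & e \in edges H.

End SGraphTheory.

(* Main.v *)
(** Take a random set J of pairs, each pair being chosen independently with
    probability p = 1 / (4 sqrt n), and delete from J the union of a maximal
    family of pairwise edge-disjoint triangles of J: what remains is a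
    triangle-free graph G.  If G misses H, then the deleted triangles that meet
    H form an edge-disjoint family T such that J contains the union U of T and
    misses H \ U.  For a given T this has probability at most
    p^(3|T|) (1 - p)^(e(H) - 3|T|); since at most n e(H) triangles meet H,
    summing over T bounds the probability that G misses H by
    (1 - p)^e(H) (1 + p^3 / (1 - p)^3)^(n e(H)) <= exp(- e(H) / (8 sqrt n)),
    and a union bound over H concludes. *)
Require Import Defs.
From HB Require Import structures.
From mathcomp Require Import all_boot all_order all_algebra.
From mathcomp Require Import ring lra.
From mathcomp Require Import reals sequences exp.
Set Implicit Arguments.
Unset Strict Implicit.
Unset Printing Implicit Defensive.
Import Order.TTheory GRing.Theory Num.Theory.
Local Open Scope ring_scope.

(** * Maximal packings, and the binomial theorem over subsets *)

(** An inclusion-maximal packing works: a member of [D] surviving in [J :\: cover T] could be added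
    to it. The empty set survives every deletion, so it must not belong to [D]. *)
Lemma maximal_packing (E : finType) (D : {set {set E}}) (J : {set E}) :
  set0 \notin D ->
  exists T : {set {set E}}, [/\ T \subset D, trivIset T, cover T \subset J &
    forall t, t \in D -> ~~ (t \subset J :\: cover T)].
Proof.
move=> D0.
pose P (T : {set {set E}}) := [&& T \subset D, trivIset T & cover T \subset J].
have P0 : P set0.
  rewrite /P /cover big_set0 !sub0set /= andbT.
  by apply/trivIsetP=> A B; rewrite inE.
have [T /maxsetP [/and3P [TD trT TJ] maxT] _] := maxset_exists P0.
exists T; split=> // t tD; apply/negP; rewrite subsetD => /andP[tJ tT].
have T0 : set0 \notin T by apply: contra D0; apply: (subsetP TD).
have tdisj : {in T, forall B : {set E}, [disjoint t & B]}.
  by move=> B BT; apply: disjointWr tT; apply: bigcup_sup.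
have [trtT ntT] := trivIsetU1 tdisj trT T0.
move: ntT; rewrite -(maxT (t |: T)) ?setU11 //; last exact: subsetUr.
rewrite /P trtT subUset sub1set tD TD /=.
by apply/bigcupsP=> B /setU1P[->//|BT]; apply: subset_trans TJ; apply: bigcup_sup.
Qed.

Lemma sum_subset_expr (R : comNzRingType) (I : finType) (A : {set I}) (r : R) :
  \sum_(B : {set I} | B \subset A) r ^+ #|B| = (1 + r) ^+ #|A|.
Proof.
rewrite -prodr_const [RHS]big_mkcond /=.
under [RHS]eq_bigr => i _.
  (* When the product is distributed, the summand 0 outside [A] kills every [B] not contained in
     [A]. *)
  have -> : (if i \in A then 1 + r else 1) = (if i \in A then r else 0) + 1.
    by case: ifP => _; rewrite ?add0r // addrC.
  over.
rewrite bigA_distr big_mkcond /=; apply: eq_bigr => B _.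
case: ifPn => [BA|/subsetPn[x xB xA]].
  rewrite -prodr_const big_mkcond /=; apply: eq_bigr => i _.
  by case: ifP => // iB; rewrite (subsetP BA).
by rewrite (bigD1 x) //= xB (negPf xA) mul0r.
Qed.

(** * Binomial random subsets of a finite ground set *)

Section RandomSubset.

Variables (R : realFieldType) (E : finType) (p : R).
Hypotheses (p_ge0 : 0 <= p) (p_lt1 : p < 1).

Definition bernoulli_weight (J : {set E}) : R :=
  \prod_i (if i \in J then p else 1 - p).

Lemma bernoulli_weight_ge0 J : 0 <= bernoulli_weight J.
Proof. by apply: prodr_ge0 => i _; case: ifP => _ //; rewrite subr_ge0 ltW. Qed.

Lemma bernoulli_weight_cylinder (A B : {set E}) : [disjoint A & B] ->
  \sum_(J : {set E} | (A \subset J) && [disjoint B & J]) bernoulli_weight J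
    = p ^+ #|A| * (1 - p) ^+ #|B|.
Proof.
move=> dAB.
(* Each factor equals [p] on [A], [1 - p] on [B] and 1 elsewhere; the zeros kill every [J] outside
   the cylinder. *)
have -> : p ^+ #|A| * (1 - p) ^+ #|B| =
    \prod_i ((if i \in B then 0 else p) + (if i \in A then 0 else 1 - p)).
  rewrite -!prodr_const [X in X * _]big_mkcond [X in _ * X]big_mkcond.
  rewrite -big_split /=; apply: eq_bigr => i _.
  case: (boolP (i \in A)) => iA; first by rewrite (disjointFr dAB iA) mulr1 addr0.
  by case: (i \in B); rewrite mul1r ?add0r // addrC subrK.
rewrite bigA_distr big_mkcond /=; apply: eq_bigr => J _.
case: ifPn => [/andP[AJ BJ]|].
  apply: eq_bigr => i _; case: ifPn => iJ; first by rewrite (disjointFl BJ).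
  by case: ifPn => // iA; rewrite (subsetP AJ) in iJ.
rewrite negb_and => /orP[/subsetPn[x xA xJ]|/pred0Pn[x /andP[xB xJ]]].
  by rewrite (bigD1 x) //= (negPf xJ) xA mul0r.
by move: xB xJ => /= xB xJ; rewrite (bigD1 x) //= xJ xB mul0r.
Qed.

Lemma bernoulli_weight_total : \sum_J bernoulli_weight J = 1.
Proof.
have d0 (J : {set E}) : [disjoint set0 & J] by rewrite disjoints_subset sub0set.
have := bernoulli_weight_cylinder (d0 set0).
rewrite cards0 !expr0 mulr1 => <-; apply: eq_bigl => J.
by rewrite sub0set d0.
Qed.

Variables (k : nat) (D : {set {set E}}).
Hypotheses (k_gt0 : (0 < k)%N) (cardD : {in D, forall t : {set E}, #|t| = k}).

Definition meeting (H : {set E}) : {set {set E}} :=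
  [set t in D | ~~ [disjoint t & H]].

Definition covered (H J : {set E}) (T : {set {set E}}) : bool :=
  (cover T \subset J) && [disjoint H :\: cover T & J].

(** Each inner sum is the weight of a cylinder. As [cover T] has [k * #|T|] elements, at least
    [#|H| - k * #|T|] elements of [H] are avoided, which bounds it by [(1 - p) ^+ #|H|] times the
    [#|T|]-th power of [(p / (1 - p)) ^+ k]. The sum is then extended to all subfamilies of
    [meeting H]. *)
Lemma covered_weight_le (H : {set E}) :
  \sum_(T : {set {set E}} | (T \subset meeting H) && trivIset T)
     \sum_(J : {set E} | covered H J T) bernoulli_weight J
  <= (1 - p) ^+ #|H| * (1 + (p / (1 - p)) ^+ k) ^+ #|meeting H|.
Proof.
have q_gt0 : 0 < 1 - p by rewrite subr_gt0.
have r_ge0 : 0 <= (p / (1 - p)) ^+ k by rewrite exprn_ge0 // divr_ge0 // ltW.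
rewrite -[X in _ <= _ * X]sum_subset_expr mulr_sumr.
rewrite big_mkcondr /=; apply: ler_sum => T TH.
case: ifP => trT; last by apply: mulr_ge0; apply: exprn_ge0 => //; apply: ltW.
have cT : #|cover T| = (k * #|T|)%N.
  have [_] := leq_card_cover T; rewrite trT => /eqP ->.
  rewrite (eq_bigr (fun=> k)) ?sum_nat_const 1?mulnC // => t tT.
  by apply: cardD; have := subsetP TH _ tT; rewrite inE => /andP[].
rewrite bernoulli_weight_cylinder; last first.
  by rewrite disjoint_sym disjoints_subset subsetDr.
rewrite -exprM -cT expr_div_n mulrCA ler_wpM2l ?exprn_ge0 //.
rewrite ler_pdivlMr ?exprn_gt0 // -exprD.
apply: ler_wiXn2l; [exact: ltW | by rewrite gerBl |].
by rewrite -(cardsID (cover T) H) addnC leq_add2l subset_leq_card // subsetIr.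
Qed.

(** If no such [G] existed, every [J] would lie in a [covered] event for some [i] and [T], so these
    events would have total weight at least 1. *)
Lemma free_transversal (I : finType) (A : {set I}) (H : I -> {set E}) :
  \sum_(i in A)
     (1 - p) ^+ #|H i| * (1 + (p / (1 - p)) ^+ k) ^+ #|meeting (H i)| < 1 ->
  exists G : {set E}, (forall t, t \in D -> ~~ (t \subset G)) /\
    (forall i, i \in A -> ~~ [disjoint G & H i]).
Proof.
move=> sum_lt1.
pose good (G : {set E}) := [forall t in D, ~~ (t \subset G)]
  && [forall i in A, ~~ [disjoint G & H i]].
case: (boolP [exists G, good G]) => [/existsP[G /andP[/forall_inP ? /forall_inP ?]]|].
  by exists G.
rewrite negb_exists => /forallP bad; exfalso.
have D0 : set0 \notin D.
  by apply/negP => /cardD; rewrite cards0 => k0; move: k_gt0; rewrite -k0.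
have bad_witness (J : {set E}) : exists i (T : {set {set E}}), [/\ i \in A,
    (T \subset meeting (H i)) && trivIset T & covered (H i) J T].
  have [T [TD trT TJ freeT]] := maximal_packing J D0.
  move: (bad (J :\: cover T)); rewrite negb_and => /orP[|].
    by case/negP; apply/forall_inP.
  rewrite negb_forall_in => /exists_inP[i iA]; rewrite negbK => dH.
  exists i, (T :&: meeting (H i)); split=> //.
    rewrite subsetIr /=; apply: trivIsetS trT; exact: subsetIl.
  apply/andP; split.
    apply: subset_trans TJ; apply/bigcupsP=> t /setIP[tT _].
    exact: bigcup_sup.
  (* An element of [H i] in [J] was deleted by some member of the packing; that member meets [H i],
     so it is kept in the restricted family. *)
  rewrite disjoints_subset; apply/subsetP=> e /setDP[eH eT].
  rewrite inE; apply/negP => eJ.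
  have := disjointFl dH eH; rewrite inE eJ andbT => /negbFE /bigcupP[t tT et].
  case/negP: eT; apply/bigcupP; exists t => //.
  rewrite !inE tT (subsetP TD) //=; apply/pred0Pn; exists e.
  by rewrite /= et eH.
move: sum_lt1; apply/negP; rewrite -leNgt -[leLHS]bernoulli_weight_total.
apply: le_trans (ler_sum _ (fun i _ => covered_weight_le (H i))).
under [leRHS]eq_bigr => i _.
  under eq_bigr => T _ do rewrite big_mkcond /=.
  rewrite exchange_big /=; over.
rewrite exchange_big /=; apply: ler_sum => J _.
have [i [T [iA TH cov]]] := bad_witness J.
have term_ge0 j (S : {set {set E}}) : 0 <= (if covered (H j) J S then bernoulli_weight J else 0).
  by case: ifP => _ //; exact: bernoulli_weight_ge0.
rewrite (bigD1 i) //= (bigD1 T) //= cov -addrA lerDl addr_ge0 //.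
  exact: sumr_ge0.
by apply: sumr_ge0 => j _; apply: sumr_ge0.
Qed.

End RandomSubset.

(** * Triangles as sets of edges *)

Section Triangles.

Variable V : finType.

Definition pairs_in (s : {set V}) : {set {set V}} :=
  [set e : {set V} | (e \subset s) && (#|e| == 2)%N].

Definition triangles : {set {set {set V}}} :=
  [set pairs_in s | s in [set s : {set V} | #|s| == 3%N]].

Lemma card_triangle : {in triangles, forall t : {set {set V}}, #|t| = 3%N}.
Proof.
by move=> t /imsetP[s + ->]; rewrite inE => /eqP s3; rewrite cards_draws s3.
Qed.

(** A triangle meeting [H] is determined by an edge shared with [H] and its third vertex. *)
Lemma card_meeting_triangles (H : {set {set V}}) :
  (#|meeting triangles H| <= #|H| * #|V|)%N.
Proof.
pose f (ev : {set V} * V) := pairs_in (ev.2 |: ev.1).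
rewrite -(cardsT V) -cardsX; apply: leq_trans (leq_imset_card f _).
apply: subset_leq_card; apply/subsetP=> t; rewrite inE => /andP[].
case/imsetP=> s; rewrite inE => /eqP s3 ->.
case/pred0Pn=> e /andP[/=]; rewrite inE => /andP[es /eqP e2] eH.
have /cards1P[v sv] : #|s :\: e| == 1%N by rewrite cardsDS // s3 e2.
apply/imsetP; exists (e, v); first by rewrite !inE eH.
by rewrite /f /= -sv setUC -[in LHS](setID s e) (setIidPr es).
Qed.

Lemma pairs_in_set3 (x y z : V) (e : {set V}) :
  e \in pairs_in [set x; y; z] ->
  [\/ e = [set x; y], e = [set y; z] | e = [set x; z]].
Proof.
rewrite inE => /andP[/subsetP es /cards2P[a [b [ab eE]]]].
have := es a; have := es b; rewrite {es}eE !inE !eqxx orbT.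
move=> /(_ isT) bE /(_ isT) aE.
move: aE bE => /orP[/orP[]|] /eqP aE /orP[/orP[]|] /eqP bE;
  move: ab; rewrite {}aE {}bE ?eqxx // => _.
all: try by [constructor 1|constructor 2|constructor 3].
all: by [constructor 1; rewrite setUC|constructor 2; rewrite setUC
  |constructor 3; rewrite setUC].
Qed.

(** The random set is drawn from all of [{set V}], hence the filter on size 2. *)
Definition graph_of (G : {set {set V}}) : sgraph V.
Proof.
exists [set e in G | #|e| == 2%N].
by apply/forall_inP => e; rewrite inE => /andP[].
Defined.

Lemma edges_graph_of G e : (e \in edges (graph_of G)) = (e \in G) && (#|e| == 2)%N.
Proof. by rewrite inE. Qed.

Lemma card_edge (H : sgraph V) e : e \in edges H -> #|e| == 2%N.
Proof. by case: H => /= F /forall_inP; apply. Qed.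

Lemma graph_of_triangle_free (G : {set {set V}}) :
  (forall t, t \in triangles -> ~~ (t \subset G)) -> triangle_free (graph_of G).
Proof.
move=> freeG x y z []; rewrite /Defs.adjacent !edges_graph_of !cards2.
move=> /andP[Gxy xy] /andP[Gyz yz] /andP[Gxz xz].
have {}xy : x != y by case: (x != y) xy.
have {}yz : y != z by case: (y != z) yz.
have {}xz : x != z by case: (x != z) xz.
suff /freeG : pairs_in [set x; y; z] \in triangles.
  by case/negP; apply/subsetP => e /pairs_in_set3[] ->.
apply: imset_f; rewrite inE setUC cardsU1 cards2 xy !inE.
by rewrite negb_or !(eq_sym z) xz yz.
Qed.

End Triangles.

(** * Numerical estimate and conclusion *)

(** Let [r] be the cube of [p / (1 - p)]. By [1 + x <= expR x] the left side is at most
    [expR (- m * (p - r * n))]. The choice of [p] makes [r * n <= p / 2], and [p / 2] is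
    [8^-1 / s]. *)
Lemma missing_probability_le (R : realType) (n m N : nat) (p : R) :
  (0 < n)%N -> (N <= m * n)%N -> p = 4^-1 / Num.sqrt n%:R ->
  (1 - p) ^+ m * (1 + (p / (1 - p)) ^+ 3) ^+ N
    <= expR (- (8^-1 * m%:R / Num.sqrt n%:R)).
Proof.
move=> n_gt0 leN; set s : R := Num.sqrt n%:R => pE.
have s_ge1 : 1 <= s by rewrite /s -[leLHS]sqrtr1 ler_wsqrtr // ler1n.
have s_gt0 : 0 < s by lra.
have s2 : s ^+ 2 = n%:R by rewrite sqr_sqrtr.
have p_gt0 : 0 < p by rewrite pE divr_gt0 //; lra.
have p_le : p <= 4^-1 by rewrite pE ler_pdivrMr // ler_peMr //; lra.
have ps : p * s = 4^-1 by rewrite pE divfK // gt_eqF.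
set r := (p / (1 - p)) ^+ 3.
have r_ge0 : 0 <= r by apply/exprn_ge0/divr_ge0; lra.
have rn : r * n%:R <= p / 2.
  have x_le : p / (1 - p) <= 4 / 3 * p.
    by rewrite ler_pdivrMr; [nra|lra].
  have x_ge0 : 0 <= p / (1 - p) by apply: divr_ge0; lra.
  have : r <= (4 / 3 * p) ^+ 3 by rewrite lerXn2r // nnegrE; lra.
  have n_ge0 : 0 <= n%:R :> R by [].
  move=> /(ler_wpM2r n_ge0) /le_trans; apply.
  (* Two factors [p] absorb [n = s ^+ 2]: as [p * s = 1/4], what remains is [4/27 * p]. *)
  have -> : (4 / 3 * p) ^+ 3 * n%:R = 64 / 27 * p * (p * s) ^+ 2.
    by rewrite -s2; field.
  by rewrite ps; nra.
apply: (@le_trans _ _ (expR (- p) ^+ m * expR r ^+ (m * n))).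
  apply: ler_pM; rewrite ?exprn_ge0 //; try lra.
    by rewrite lerXn2r ?nnegrE ?expR_ge0 ?expR_ge1Dx //; lra.
  apply: (@le_trans _ _ ((1 + r) ^+ (m * n))).
    by apply: ler_weXn2l => //; lra.
  by rewrite lerXn2r ?nnegrE ?expR_ge0 ?expR_ge1Dx //; lra.
rewrite -!expRM_natl -expRD ler_expR natrM.
have -> : - (8^-1 * m%:R / s) = - (m%:R * (p / 2)) by rewrite pE; field; lra.
have := ler_wpM2l (ler0n R m) rn; lra.
Qed.

Theorem theorem1p4 (R : realType) :
  exists2 delta : R, 0 < delta &
  exists n0 : nat, forall n : nat, (n0 <= n)%N ->
  forall Hs : {set sgraph 'I_n},
    \sum_(H in Hs) expR (- (delta * (num_edges H)%:R / Num.sqrt n%:R))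
      < 1 / 2 :> R ->
  exists2 G : sgraph 'I_n, triangle_free G &
    forall H : sgraph 'I_n, H \in Hs -> share_edge G H.
Proof.
exists 8^-1; first lra.
exists 1%N => n n_gt0 Hs sum_lt.
pose p : R := 4^-1 / Num.sqrt n%:R.
have s_ge1 : 1 <= Num.sqrt n%:R :> R.
  by rewrite -[leLHS]sqrtr1 ler_wsqrtr // ler1n.
have p_ge0 : 0 <= p by apply: divr_ge0; lra.
have p_lt1 : p < 1 by rewrite ltr_pdivrMr; lra.
(* The ground set is [{set 'I_n}], and the sets to be avoided are the triangles, with [k = 3]. *)
have [|G [freeG hitG]] := @free_transversal R _ p p_ge0 p_lt1 3
    (triangles 'I_n) isT (@card_triangle _) _ Hs (@edges _).
  apply: le_lt_trans (_ : 1 / 2 < 1); last lra.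
  apply: le_trans (ltW sum_lt); apply: ler_sum => H _.
  apply: missing_probability_le => //.
  by apply: leq_trans (card_meeting_triangles _) _; rewrite card_ord.
exists (graph_of G); first exact: graph_of_triangle_free.
move=> H /hitG /pred0Pn[e /andP[/= eG eH]].
(* The common element is an edge of [H], so it has size 2 and passes the filter in [graph_of]. *)
by exists e; rewrite // edges_graph_of eG (card_edge eH).
Qed.
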